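(* Let $\mathcal V$ be a finite vocabulary, let $M$ be a nonempty finite set of masked positions (a set of positive integers), let $(X,Y_U)$ be a fixed context, let $P_\theta$ be the model's conditional distributions at the positions of $M$ given this context, and let $D=(D_{a,b})_{a\neq b\in M}$ be the true pairwise dependency matrix of $P_\theta$ (all as defined in the context). Let $\gamma\in\mathbb R$ be a confidence threshold and $\tau\ge 0$ an error threshold. Run the Greedy Subset Selection algorithm described in the context with inputs $D$, $M$, the top-1 probabilities of $P_\theta$, $\gamma$ and $\tau$. Let $S=\{s_1,\dots,s_k\}\subseteq M$ be the returned set, with its elements listed in the order in which the algorithm selected them. Suppose that the following sub-additivity assumption holds: for every $t\in\{2,\dots,k\}$, $$\mathbb E_{Y_{s_{<t}}}\Big[\mathrm{TV}\big(P_\theta(Y_{s_t}\mid X,Y_U),\,P_\theta(Y_{s_t}\mid X,Y_U,Y_{s_{<t}})\big)\Big]\le\sum_{j=1}^{t-1}D_{s_t,s_j},$$ where $Y_{s_{<t}}=(Y_{s_1},\dots,Y_{s_{t-1}})$ is distributed according to the model's joint distribution $P_\theta(Y_{s_{<t}}\mid X,Y_U)$. Then $$\mathrm{TV}\big(P_\theta(Y_S\mid X,Y_U),\,Q_\theta(Y_S\mid X,Y_U)\big)\le\tau,$$ where $P_\theta(Y_S\mid X,Y_U)$ is the model's joint distribution of $Y_S=(Y_{s_1},\dots,Y_{s_k})$ and $Q_\theta(Y_S\mid X,Y_U)$ is its fully factorized approximation.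
   Context: **Total variation.** For probability distributions $P,Q$ on a finite set $\mathcal X$, $\mathrm{TV}(P,Q)=\frac12\sum_{x\in\mathcal X}|P(x)-Q(x)|$. **Model.** $X$ is a prompt and $Y_U$ is the tuple of already revealed tokens; both are fixed throughout. For each position $m\in M$, $Y_m$ is a $\mathcal V$-valued random variable (the token at $m$). For every finite (possibly empty) set $A\subseteq M$, every assignment $y_A\in\mathcal V^A$ and every $m\in M\setminus A$, the model supplies a probability distribution $P_\theta(Y_m\mid X,Y_U,y_A)$ on $\mathcal V$; for $A=\emptyset$ it is written $P_\theta(Y_m\mid X,Y_U)$ and called the marginal at $m$. **Joint and factorized distributions.** For distinct positions $s_1,\dots,s_k\in M$ listed in a given order (for a selected set, the order of selection), write $y_{s_{<j}}=(y_{s_1},\dots,y_{s_{j-1}})$. The model's joint distribution on $\mathcal V^k$ is given by the chain rule $$P_\theta(y_{s_1},\dots,y_{s_k}\mid X,Y_U)=\prod_{j=1}^{k}P_\theta(y_{s_j}\mid X,Y_U,y_{s_{<j}}),$$ and in particular $P_\theta(Y_{s_{<t}}\mid X,Y_U)$ is the same expression for the initial segment $s_1,\dots,s_{t-1}$. The fully factorized approximation is $$Q_\theta(y_{s_1},\dots,y_{s_k}\mid X,Y_U)=\prod_{j=1}^{k}P_\theta(y_{s_j}\mid X,Y_U).$$ **Pairwise dependency matrix.** For distinct $a,b\in M$, $$D_{a,b}=\mathbb E_{Y_b\sim P_\theta(\cdot\mid X,Y_U)}\Big[\mathrm{TV}\big(P_\theta(Y_a\mid X,Y_U),\,P_\theta(Y_a\mid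 X,Y_U,Y_b)\big)\Big]\in[0,1],$$ where $Y_b$ is drawn from its marginal. In general $D_{a,b}\ne D_{b,a}$. **Top-1 probabilities.** $p_{\mathrm{top1}}[c]=\max_{v\in\mathcal V}P_\theta(Y_c=v\mid X,Y_U)$ for $c\in M$. **Greedy Subset Selection algorithm** (inputs $D,M,p_{\mathrm{top1}},\gamma,\tau$): 1. Set $s_1=\min(M)$, $S=\{s_1\}$, $\mathcal D_{\mathrm{accum}}=0$. 2. Repeat: (i) Let $\mathcal C=\{c\in M\setminus S: p_{\mathrm{top1}}[c]>\gamma\}$. If $\mathcal C=\emptyset$, stop. (ii) Choose $c^*\in\arg\min_{c\in\mathcal C}\sum_{s\in S}D_{c,s}$ (ties broken arbitrarily) and set $\Delta^*=\sum_{s\in S}D_{c^*,s}$. (iii) If $\mathcal D_{\mathrm{accum}}+\Delta^*>\tau$, stop. Otherwise replace $S$ by $S\cup\{c^*\}$ (so $c^*$ is the next selected position) and $\mathcal D_{\mathrm{accum}}$ by $\mathcal D_{\mathrm{accum}}+\Delta^*$. 3. Return $S$. *)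

(* Defs.v *)
From mathcomp Require Import all_boot all_order all_algebra.
From mathcomp Require Import finmap.

Set Implicit Arguments.
Unset Strict Implicit.
Unset Printing Implicit Defensive.

Import Order.TTheory GRing.Theory Num.Theory.

Local Open Scope fset_scope.
Local Open Scope fmap_scope.
Local Open Scope ring_scope.

Section Distributions.
Variables (R : realFieldType) (T : finType).
Implicit Types P Q : T -> R.

Definition is_distr P : Prop := (forall x, 0 <= P x) /\ \sum_x P x = 1.

Definition TV P Q : R := 2^-1 * \sum_x `|P x - Q x|.

Definition expect P (f : T -> R) : R := \sum_x P x * f x.

End Distributions.

Section Model.
Variables (R : realFieldType) (V : finType).

(* [P m y v] is the probability of the token [v] at position [m], given the   *)
(* fixed context (X, Y_U) and the partial assignment [y], whose domain        *)
(* [domf y] is the set A of conditioning positions. The values of [P] are     *)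
(* constrained only for A a subset of M and m in M \ A.                       *)
Definition cond_family := nat -> {fmap nat -> V} -> V -> R.

Definition is_model (M : {fset nat}) (P : cond_family) : Prop :=
  forall (m : nat) (y : {fmap nat -> V}),
    m \in M -> domf y `<=` M -> m \notin domf y -> is_distr (P m y).

Variable P : cond_family.

Definition marginal (m : nat) : V -> R := P m [fmap].

(* The assignment s_i |-> y_i, for a duplicate-free s of the same size as y.  *)
Definition assign (s : seq nat) (y : seq V) : {fmap nat -> V} :=
  foldr (fun (p : nat * V) (f : {fmap nat -> V}) => f.[p.1 <- p.2])
        [fmap] (zip s y).

Definition joint (s : seq nat) (y : (size s).-tuple V) : R :=
  \prod_(j < size s) P (nth 0%N s j) (assign (take j s) (take j y)) (tnth y j).

Definition factorized (s : seq nat) (y : (size s).-tuple V) : R :=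
  \prod_(j < size s) marginal (nth 0%N s j) (tnth y j).

Definition dependency (a b : nat) : R :=
  expect (marginal b)
    (fun v => TV (marginal a) (P a [fmap].[b <- v])).

(* The default 0 of the iterated maximum is harmless: probabilities are       *)
(* nonnegative, and V is nonempty as soon as it carries a distribution.       *)
Definition top1 (c : nat) : R := \big[Num.max/0]_(v : V) marginal c v.

End Model.

Section GreedySubsetSelection.
Variables (R : realFieldType) (D : nat -> nat -> R) (M : {fset nat}).
Variables (ptop1 : nat -> R) (gamma tau : R).

Definition candidates (S : seq nat) : {fset nat} :=
  [fset c in M | (c \notin S) && (gamma < ptop1 c)].

Definition cost (S : seq nat) (c : nat) : R := \sum_(s <- S) D c s.

Definition is_best (S : seq nat) (c : nat) : Prop :=
  c \in candidates S /\
  forall c', c' \in candidates S -> cost S c <= cost S c'.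

(* [greedy_loop S acc S'] : entered with the selection S, listed in order of  *)
(* selection, and accumulated cost acc, the loop can return S'. It is a       *)
(* relation rather than a function because ties are broken arbitrarily.       *)
Inductive greedy_loop : seq nat -> R -> seq nat -> Prop :=
| greedy_exhausted S acc :
    candidates S = fset0 -> greedy_loop S acc S
| greedy_over_budget S acc c :
    is_best S c -> tau < acc + cost S c -> greedy_loop S acc S
| greedy_select S acc c S' :
    is_best S c -> acc + cost S c <= tau ->
    greedy_loop (rcons S c) (acc + cost S c) S' -> greedy_loop S acc S'.

Definition greedy_returns (S : seq nat) : Prop :=
  exists s1 : nat,
    [/\ s1 \in M, forall m, m \in M -> (s1 <= m)%N
      & greedy_loop [:: s1] 0 S].

End GreedySubsetSelection.

(* Main.v *)
(* Appending one position c to s replaces the pair (joint, factorized) by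
   J(y) p(v | y) and F(y) q(v), where q is the marginal at c, and
     |J p - F q| <= J |p - q| + |J - F| q.
   Summing over (y, v), the error grows by at most the expected total variation
   at c. So TV(P, Q) is at most the sum of these expectations, hence, by
   sub-additivity, at most the cost accumulated by the greedy loop. *)

Require Import Defs.
From mathcomp Require Import all_boot all_order all_algebra.
From mathcomp Require Import finmap.

Set Implicit Arguments.
Unset Strict Implicit.
Unset Printing Implicit Defensive.

Import Order.TTheory GRing.Theory Num.Theory.

Local Open Scope fset_scope.
Local Open Scope fmap_scope.
Local Open Scope ring_scope.

(** Appending a last entry is injective between finite types of equal cardinality, hence bijective.
    The equation [e] is a parameter because [size (rcons s c)] is not convertible to
    [(size s).+1]. *)
Lemma sum_tuple_rcons (R : nmodType) (V : finType) (n m : nat)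
    (e : n.+1 = m) (F : m.-tuple V -> R) :
  \sum_w F w = \sum_(y : n.-tuple V) \sum_(v : V) F (tcast e (rcons_tuple y v)).
Proof.
case: m / e F => F; rewrite pair_big /=.
rewrite (reindex (fun p : n.-tuple V * V => rcons_tuple p.1 p.2)) //=.
apply/onW_bij/inj_card_bij; last by rewrite card_prod !card_tuple expnSr.
move=> [y v] [y' v'] /(congr1 val)/rcons_inj/= [yE ->].
by congr (_, _); exact: val_inj.
Qed.

Section ChainRule.
Variables (R : realFieldType) (V : finType) (P : cond_family R V).
Implicit Types (s : seq nat) (c : nat).

Lemma domf_assign s (y : seq V) : {subset domf (assign s y) <= s}.
Proof.
elim: s y => [|a s IHs] [|v y] k //; rewrite /assign /= ?in_fset0 //.
by rewrite in_fset1U inE => /orP[->//|/IHs ->]; rewrite orbT.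
Qed.

Lemma joint_rcons s c (y : (size s).-tuple V) (v : V)
    (w : (size (rcons s c)).-tuple V) : tval w = rcons y v ->
  joint P w = joint P y * P c (assign s y) v.
Proof.
move=> wE; rewrite /joint.
(* Passing to [nth] on the underlying sequence lets [wE] rewrite without transport between tuple
   types; the default [v] is never reached. *)
under eq_bigr => j _ do rewrite (tnth_nth v) wE.
under [in RHS]eq_bigr => j _ do rewrite (tnth_nth v).
rewrite size_rcons big_ord_recr /=; congr (_ * _).
  apply: eq_bigr => j _; rewrite !nth_rcons size_tuple ltn_ord.
  by rewrite -!cats1 !takel_cat ?size_tuple // ltnW.
rewrite !nth_rcons size_tuple ltnn eqxx -!cats1 !takel_cat ?size_tuple //.
by rewrite take_size take_oversize // size_tuple.
Qed.

Lemma factorized_rcons s c (y : (size s).-tuple V) (v : V)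
    (w : (size (rcons s c)).-tuple V) : tval w = rcons y v ->
  factorized P w = factorized P y * marginal P c v.
Proof.
move=> wE; rewrite /factorized.
under eq_bigr => j _ do rewrite (tnth_nth v) wE.
under [in RHS]eq_bigr => j _ do rewrite (tnth_nth v).
rewrite size_rcons big_ord_recr /=; congr (_ * _).
  by apply: eq_bigr => j _; rewrite !nth_rcons size_tuple ltn_ord.
by rewrite !nth_rcons size_tuple ltnn eqxx.
Qed.

(** The left-hand side of the sub-additivity assumption, for the prefix [s] followed by [c]. *)
Definition chain_error s c : R :=
  expect (@joint R V P s)
    (fun y => TV (marginal P c) (P c (assign s y))).

Lemma chain_error_nil c : chain_error [::] c = 0.
Proof.
rewrite /chain_error /expect big1 // => y _.
by rewrite (tuple0 y) /TV big1 ?mulr0 // => v _; rewrite subrr normr0.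
Qed.

Variable M : {fset nat}.
Hypothesis P_model : is_model M P.

Lemma model_assign_distr s c (y : seq V) :
  uniq (rcons s c) -> {subset rcons s c <= M} -> is_distr (P c (assign s y)).
Proof.
rewrite rcons_uniq => /andP[c_s _] sM; apply: P_model.
- by apply: sM; rewrite mem_rcons mem_head.
- by apply/fsubsetP => k /domf_assign ks; apply: sM; rewrite mem_rcons inE ks orbT.
- by apply: contra c_s => /domf_assign.
Qed.

(** Each factor is a value of a genuine distribution: by uniqueness of [s], position [j] lies
    outside the prefix it is conditioned on. *)
Lemma joint_ge0 s (y : (size s).-tuple V) :
  uniq s -> {subset s <= M} -> 0 <= joint P y.
Proof.
move=> s_uniq sM; apply: prodr_ge0 => j _.
have rconsE : rcons (take j s) (nth 0%N s j) = take j.+1 s.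
  by rewrite (take_nth 0%N).
have [] := @model_assign_distr (take j s) (nth 0%N s j) (take j y).
- by rewrite rconsE take_uniq.
- by rewrite rconsE => k /mem_take /sM.
- by move=> ge0 _; apply: ge0.
Qed.

Lemma TV_joint_factorized_rcons s c :
  uniq (rcons s c) -> {subset rcons s c <= M} ->
  TV (@joint R V P (rcons s c)) (@factorized R V P (rcons s c))
    <= TV (@joint R V P s) (@factorized R V P s) + chain_error s c.
Proof.
move=> sc_uniq scM.
have s_uniq : uniq s by move: sc_uniq; rewrite rcons_uniq => /andP[].
have sM : {subset s <= M}.
  by move=> k ks; apply: scM; rewrite mem_rcons inE ks orbT.
have [q_ge0 q_sum1] : is_distr (marginal P c).
  by apply: P_model; rewrite ?fsub0set // scM // mem_rcons mem_head.
rewrite /chain_error /expect /TV.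
(* The factor [2^-1] is moved out of the expectation so that it cancels on both sides. *)
under [X in _ <= _ + X]eq_bigr => y _ do rewrite mulrCA.
rewrite -mulr_sumr -mulrDr ler_pM2l ?invr_gt0 ?ltr0n // -big_split /=.
rewrite (sum_tuple_rcons (esym (size_rcons s c))); apply: ler_sum => y _.
(* Spreading the old error over the total mass 1 of the marginal at [c] reduces the claim to one
   inequality per pair [(y, v)]. *)
rewrite -[X in X + _]mulr1 -[X in _ * X + _]q_sum1 !mulr_sumr -big_split /=.
apply: ler_sum => v _.
have wE : tval (tcast (esym (size_rcons s c)) (rcons_tuple y v)) = rcons y v.
  by rewrite val_tcast.
rewrite (joint_rcons wE) (factorized_rcons wE).
have J_ge0 := joint_ge0 y s_uniq sM.
(* Triangle inequality through the mixed term: joint on the prefix, marginal at [c]. *)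
apply: le_trans (ler_distD (joint P y * marginal P c v) _ _) _.
rewrite -mulrBr -mulrBl !normrM (ger0_norm J_ge0) (ger0_norm (q_ge0 v)).
by rewrite addrC (distrC (marginal P c v)).
Qed.

Lemma TV_joint_factorized_le s : uniq s -> {subset s <= M} ->
  TV (@joint R V P s) (@factorized R V P s)
    <= \sum_(t < size s) chain_error (take t s) (nth 0%N s t).
Proof.
elim/last_ind: s => [|s c IHs] sc_uniq scM.
  rewrite big_ord0 /TV big1 ?mulr0 // => y _.
  by rewrite /joint /factorized !big_ord0 subrr normr0.
apply: le_trans (TV_joint_factorized_rcons sc_uniq scM) _.
rewrite size_rcons big_ord_recr /= nth_rcons ltnn eqxx -cats1 take_size_cat //.
(* Below [size s], prefixes and entries of [rcons s c] are those of [s]. *)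
rewrite (eq_bigr (fun t : 'I_(size s) =>
    chain_error (take t s) (nth 0%N s t))) => [|t _]; last first.
  by rewrite cats1 nth_rcons ltn_ord -cats1 takel_cat // ltnW.
rewrite lerD2r; apply: IHs.
  by move: sc_uniq; rewrite rcons_uniq => /andP[].
by move=> k ks; apply: scM; rewrite mem_rcons inE ks orbT.
Qed.

End ChainRule.

Section GreedyCost.
Variables (R : realFieldType) (D : nat -> nat -> R) (M : {fset nat}).
Variables (ptop1 : nat -> R) (gamma tau : R).

(** Closed form of the accumulated cost, arranged as the sum over [t] of the sub-additivity
    bounds. *)
Definition total_cost (S : seq nat) : R :=
  \sum_(t < size S) \sum_(j < t) D (nth 0%N S t) (nth 0%N S j).

Lemma total_cost_rcons S c : total_cost (rcons S c) = total_cost S + cost D S c.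
Proof.
rewrite /total_cost size_rcons big_ord_recr /=; congr (_ + _).
  apply: eq_bigr => t _; apply: eq_bigr => j _.
  by rewrite !nth_rcons ltn_ord (ltn_trans (ltn_ord j)).
rewrite /cost (big_nth 0%N) big_mkord; apply: eq_bigr => j _.
by rewrite !nth_rcons ltnn eqxx ltn_ord.
Qed.

(** Both stopping rules return the current selection, already within budget. A selection step has
    passed the budget test, and candidacy puts [c] in [M] and outside [S]. *)
Lemma greedy_loop_invariant S acc S' :
    greedy_loop D M ptop1 gamma tau S acc S' ->
    acc = total_cost S -> acc <= tau -> uniq S -> {subset S <= M} ->
  [/\ total_cost S' <= tau, uniq S' & {subset S' <= M}].
Proof.
elim=> {S acc S'} [S acc _ -> //|S acc c _ _ -> //|].
move=> S acc c S' [c_cand _] le_tau _ IH accE _ S_uniq SM.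
have /and3P[cM cS _] : [&& c \in M, c \notin S & gamma < ptop1 c].
  by move: c_cand; rewrite !inE.
apply: IH => //.
- by rewrite total_cost_rcons accE.
- by rewrite rcons_uniq cS.
- by move=> k; rewrite mem_rcons inE => /predU1P[->|/SM].
Qed.

Lemma greedy_returns_bound S : 0 <= tau -> greedy_returns D M ptop1 gamma tau S ->
  [/\ total_cost S <= tau, uniq S & {subset S <= M}].
Proof.
move=> tau_ge0 [s1 [s1M _ /greedy_loop_invariant]]; apply=> //.
- by rewrite /total_cost big_ord1 big_ord0.
- by move=> k; rewrite inE => /eqP->.
Qed.

End GreedyCost.

Theorem theorem4p2 (R : realFieldType) (V : finType)
    (M : {fset nat}) (M_pos : forall m, m \in M -> (0 < m)%N)
    (M_neq0 : M != fset0)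
    (P : cond_family R V) (P_model : is_model M P)
    (gamma tau : R) (tau_ge0 : 0 <= tau)
    (s : seq nat)
    (s_returned : greedy_returns (dependency P) M (top1 P) gamma tau s)
    (subadditivity : forall t : nat, (0 < t < size s)%N ->
       expect (@joint R V P (take t s))
         (fun y => TV (marginal P (nth 0%N s t))
                      (P (nth 0%N s t) (assign (take t s) y)))
       <= \sum_(j < t) dependency P (nth 0%N s t) (nth 0%N s j)) :
  TV (@joint R V P s) (@factorized R V P s) <= tau.
Proof.
have [cost_le s_uniq sM] := greedy_returns_bound tau_ge0 s_returned.
apply: le_trans (TV_joint_factorized_le P_model s_uniq sM) _.
apply: le_trans cost_le; apply: ler_sum => t _.
(* Sub-additivity starts at the second selected position; at the first, nothing is conditioned on
   and both sides vanish. *)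
have [t0|t_gt0] := posnP t; last by apply: subadditivity; rewrite t_gt0 /=.
by rewrite t0 take0 chain_error_nil big_ord0.
Qed.
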